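(* Let $F$ be a piecewise conformal map of $\widehat{\mathbb C}$ such that the group $\Gamma_F$ is discrete (Kleinian), and let $\Lambda(\Gamma_F)$ be its limit set. Then $\omega(z,F)\subset\Lambda(\Gamma_F)$ for all $z\in\widehat{\mathbb C}$.
   Context: $\widehat{\mathbb C}$ is the Riemann sphere. A piecewise conformal map is a pair $(P,F)$ where $P=\{R_m\}_{m=1}^M$ is a finite partition of $\widehat{\mathbb C}$ (the $R_m$ are pairwise disjoint with union $\widehat{\mathbb C}$) such that each $R_m$ has nonempty interior and each boundary $\partial R_m$ is a finite union of simple closed curves, and $F:\widehat{\mathbb C}\to\widehat{\mathbb C}$ is a map such that each $F|_{R_m}$ is the restriction of a conformal automorphism (Möbius transformation) of $\widehat{\mathbb C}$. $\Gamma_F=\langle F|_{R_1},\dots,F|_{R_M}\rangle\subset PSL(2,\mathbb C)$ is the group generated by the Möbius transformations extending the $F|_{R_m}$; if it is discrete it is called Kleinian. It acts by isometries on the hyperbolic open unit ball $\mathbb B^3$, and its limit set $\Lambda(\Gamma_F)\subset\partial\mathbb B^3\cong\widehat{\mathbb C}$ is the set of accumulation points of an orbit $\Gamma_F p$, $p\in\mathbb B^3$. The $\omega$-limit $\omega(z,F)$ of a point $z$ is the set of accumulation points of the orbit, i.e. of the set $\{F^n(z)\}$ of forward iterates of $z$. *)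

(* Defs.v *)
From HB Require Import structures.
From mathcomp Require Import all_boot all_order all_algebra.
From mathcomp Require Import all_classical all_reals all_analysis.
From mathcomp Require Import complex ring.

Set Implicit Arguments.
Unset Strict Implicit.
Unset Printing Implicit Defensive.

Import Order.TTheory GRing.Theory Num.Theory.
Import numFieldNormedType.Exports.

Local Open Scope classical_set_scope.
Local Open Scope quotient_scope.
Local Open Scope ring_scope.
Local Open Scope complex_scope.

(* The library puts a topology on [R[i]] only through its [numFieldType]
   structure; this makes it available on the bare type. *)
HB.instance Definition _ (R : realType) :=
  PseudoPointedMetric.copy R[i] (R[i] : numFieldType).

Definition SL2 (R : realType) : Type := {A : 'M[R[i]]_2 | \det A == 1}.

Section SL2.
Variable R : realType.

HB.instance Definition _ := SubType.on (SL2 R).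
HB.instance Definition _ := [Choice of SL2 R by <:].
HB.instance Definition _ :=
  Topological.copy (SL2 R) (initial_topology (val : SL2 R -> 'M[R[i]]_2)).

Lemma det_SL2 (A : SL2 R) : \det (val A) = 1.
Proof. exact/eqP/(valP A). Qed.

Lemma unitmx_SL2 (A : SL2 R) : val A \in unitmx.
Proof. by rewrite unitmxE det_SL2 unitr1. Qed.

Fact SL2_one_subproof : \det (1%:M : 'M[R[i]]_2) == 1.
Proof. by rewrite det1. Qed.

Fact SL2_mul_subproof (A B : SL2 R) : \det (val A *m val B) == 1.
Proof. by rewrite det_mulmx !det_SL2 mulr1. Qed.

Fact SL2_inv_subproof (A : SL2 R) : \det (invmx (val A)) == 1.
Proof. by rewrite det_inv det_SL2 invr1. Qed.

Fact SL2_opp_subproof (A : SL2 R) : \det (- val A) == 1.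
Proof. by rewrite -scaleN1r detZ det_SL2 mulr1 sqrrN expr1n. Qed.

Definition SL2_one : SL2 R := Sub 1%:M SL2_one_subproof.
Definition SL2_mul (A B : SL2 R) : SL2 R :=
  Sub (val A *m val B) (SL2_mul_subproof A B).
Definition SL2_inv (A : SL2 R) : SL2 R :=
  Sub (invmx (val A)) (SL2_inv_subproof A).
Definition SL2_opp (A : SL2 R) : SL2 R :=
  Sub (- val A) (SL2_opp_subproof A).

Fact SL2_mulA : associative SL2_mul.
Proof. by move=> A B C; apply/val_inj; rewrite /= mulmxA. Qed.
Fact SL2_mul1g : left_id SL2_one SL2_mul.
Proof. by move=> A; apply/val_inj; rewrite /= mul1mx. Qed.
Fact SL2_mulg1 : right_id SL2_one SL2_mul.
Proof. by move=> A; apply/val_inj; rewrite /= mulmx1. Qed.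
Fact SL2_mulVg : left_inverse SL2_one SL2_inv SL2_mul.
Proof. by move=> A; apply/val_inj; rewrite /= mulVmx ?unitmx_SL2. Qed.
Fact SL2_mulgV : right_inverse SL2_one SL2_inv SL2_mul.
Proof. by move=> A; apply/val_inj; rewrite /= mulmxV ?unitmx_SL2. Qed.

HB.instance Definition _ := isGroup.Build (SL2 R)
  SL2_mulA SL2_mul1g SL2_mulg1 SL2_mulVg SL2_mulgV.

Definition eq_up_to_sign (A B : SL2 R) : bool := (A == B) || (A == SL2_opp B).

Lemma SL2_oppK : involutive SL2_opp.
Proof. by move=> A; apply/val_inj; rewrite /= opprK. Qed.

Fact eq_up_to_sign_equiv : equiv_class_of eq_up_to_sign.
Proof.
split=> [A|A B|B A C]; rewrite /eq_up_to_sign ?eqxx//.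
  by rewrite (eq_sym A B) -(inv_eq SL2_oppK) (eq_sym (SL2_opp A)).
by move=> /orP[] /eqP-> /orP[] /eqP->; rewrite ?SL2_oppK ?eqxx ?orbT.
Qed.

Canonical eq_up_to_sign_equiv_rel := EquivRelPack eq_up_to_sign_equiv.

End SL2.

Definition PSL2 (R : realType) : Type :=
  quotient_topology {eq_quot (@eq_up_to_sign_equiv_rel R)}.

Section PSL2.
Variable R : realType.

HB.instance Definition _ := Quotient.on (PSL2 R).
HB.instance Definition _ := Choice.on (PSL2 R).
HB.instance Definition _ := Topological.on (PSL2 R).

Lemma pi_PSL2P (A B : SL2 R) :
  \pi_(PSL2 R) A = \pi_(PSL2 R) B <-> A = B \/ A = SL2_opp B.
Proof.
have eqE : \pi_(PSL2 R) A = \pi_(PSL2 R) B <-> (A == B) || (A == SL2_opp B).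
  rewrite -[_ || _]/(eq_up_to_sign_equiv_rel R A B) -eqmodE.
  by split=> [AB|/eqP//]; apply/eqP.
rewrite eqE; split=> [/orP[]/eqP|AB]; [by left|by right|].
by apply/orP; case: AB => /eqP; [left|right].
Qed.

Definition PSL2_one : PSL2 R := \pi_(PSL2 R) 1%g.
Definition PSL2_mul (g h : PSL2 R) : PSL2 R := \pi_(PSL2 R) (repr g * repr h)%g.
Definition PSL2_inv (g : PSL2 R) : PSL2 R := \pi_(PSL2 R) (repr g)^-1%g.

Lemma repr_PSL2P (A : SL2 R) :
  repr (\pi_(PSL2 R) A) = A \/ repr (\pi_(PSL2 R) A) = SL2_opp A.
Proof. by apply/pi_PSL2P; rewrite reprK. Qed.

Lemma PSL2_mulE (A B : SL2 R) :
  PSL2_mul (\pi_(PSL2 R) A) (\pi_(PSL2 R) B) = \pi_(PSL2 R) (A * B)%g.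
Proof.
apply/pi_PSL2P.
case: (repr_PSL2P A) => ->; case: (repr_PSL2P B) => ->; [left|right|right|left];
  by apply/val_inj; rewrite /= ?mulNmx ?mulmxN ?opprK.
Qed.

Lemma PSL2_invE (A : SL2 R) :
  PSL2_inv (\pi_(PSL2 R) A) = \pi_(PSL2 R) A^-1%g.
Proof.
apply/pi_PSL2P.
case: (repr_PSL2P A) => ->; [by left|right]; apply/val_inj.
rewrite /= -scaleN1r invmxZ ?invrN1 ?scaleN1r//.
exact: (unitmx_SL2 (SL2_opp A)).
Qed.

Fact PSL2_mulA : associative PSL2_mul.
Proof.
elim/quotW=> A; elim/quotW=> B; elim/quotW=> C.
by rewrite (PSL2_mulE B C) (PSL2_mulE A B) !PSL2_mulE mulgA.
Qed.
Fact PSL2_mul1g : left_id PSL2_one PSL2_mul.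
Proof. by elim/quotW=> A; rewrite PSL2_mulE mul1g. Qed.
Fact PSL2_mulg1 : right_id PSL2_one PSL2_mul.
Proof. by elim/quotW=> A; rewrite PSL2_mulE mulg1. Qed.
Fact PSL2_mulVg : left_inverse PSL2_one PSL2_inv PSL2_mul.
Proof. by elim/quotW=> A; rewrite PSL2_invE PSL2_mulE mulVg. Qed.
Fact PSL2_mulgV : right_inverse PSL2_one PSL2_inv PSL2_mul.
Proof. by elim/quotW=> A; rewrite PSL2_invE PSL2_mulE mulgV. Qed.

HB.instance Definition _ := isGroup.Build (PSL2 R)
  PSL2_mulA PSL2_mul1g PSL2_mulg1 PSL2_mulVg PSL2_mulgV.

End PSL2.

(* [Some z] is the finite point [z], [None] is the point at infinity. *)
Definition riemann_sphere (R : realType) : Type :=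
  one_point_compactification R[i].

HB.instance Definition _ (R : realType) := Topological.on (riemann_sphere R).

Section moebius.
Variable R : realType.
Implicit Types (A : 'M[R[i]]_2) (g : PSL2 R) (z : riemann_sphere R).

(* The point with homogeneous coordinates [u : v]. *)
Definition homog (u v : R[i]) : riemann_sphere R :=
  if v == 0 then None else Some (u / v).

Definition moebius_mx A z : riemann_sphere R :=
  if z is Some w then homog (A 0 0 * w + A 0 1) (A 1 0 * w + A 1 1)
  else homog (A 0 0) (A 1 0).

(* Independent of the choice of [repr g], see [moebius_pi]. *)
Definition moebius g : riemann_sphere R -> riemann_sphere R :=
  moebius_mx (val (repr g)).

Lemma moebius_mxN A z : moebius_mx (- A) z = moebius_mx A z.
Proof.
rewrite /moebius_mx /homog; case: z => [z|]; rewrite !mxE ?mulNr -?opprD oppr_eq0;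
  by case: ifP => // _; rewrite invrN ?mulrNN ?mulNr ?mulrN ?opprK.
Qed.

Lemma moebius_pi (A : SL2 R) :
  moebius (\pi_(PSL2 R) A) = moebius_mx (val A).
Proof.
rewrite /moebius; case: (repr_PSL2P A) => -> //=.
by apply/funext => z; rewrite moebius_mxN.
Qed.

Definition sqnorm (x : 'rV[R]_3) : R := \sum_i x 0 i ^+ 2.

Definition open_unit_ball : set 'rV[R]_3 := [set x | sqnorm x < 1].

Definition vec3 (a b c : R) : 'rV[R]_3 := \row_i [:: a; b; c]`_i.

Definition mx2 (a b c d : R[i]) : 'M[R[i]]_2 :=
  \matrix_(i, j) (nth [::] [:: [:: a; b]; [:: c; d]] i)`_j.

(* Stereographic projection, identifying the sphere with the boundary of the
   ball. *)
Definition stereo z : 'rV[R]_3 :=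
  if z is Some (x +i* y) then
    let r2 := x ^+ 2 + y ^+ 2 in
    (r2 + 1)^-1 *: vec3 (2 * x) (2 * y) (r2 - 1)
  else vec3 0 0 1.

(* PSL(2,C) acts on Hermitian forms by H |-> A H A^*; identifying a Hermitian
   matrix [[t + x3, x1 + i x2], [x1 - i x2, t - x3]], of determinant
   t^2 - |x|^2, with the vector (t, x) of Minkowski space, this is an action by
   time-orientation-preserving Lorentz transformations, i.e., by isometries of
   the hyperboloid model. A point [x] of the ball corresponds to the ray of
   (1 + |x|^2, 2x), and, conversely, the ray of (t, x) corresponds to the point
   x / (t + sqrt (t^2 - |x|^2)): this is the usual passage between the conformal
   (Poincare) ball and the hyperboloid. When |x| = 1 the matrix has rank one: for
   [x = stereo z] it is a multiple of v v^* with v = (z, 1), so that the same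
   formula induces on the boundary the action of [moebius], see
   [ball_act_stereo]. *)
Definition hermitian_of_ball (x : 'rV[R]_3) : 'M[R[i]]_2 :=
  let t := 1 + sqnorm x in
  let x1 := 2 * x 0 0 in let x2 := 2 * x 0 1 in let x3 := 2 * x 0 2 in
  mx2 (t + x3)%:C (x1 +i* x2) (x1 -i* x2) (t - x3)%:C.

Definition ball_of_hermitian (H : 'M[R[i]]_2) : 'rV[R]_3 :=
  let t := complex.Re (H 0 0 + H 1 1) / 2 in
  let x := vec3 (complex.Re (H 0 1)) (complex.Im (H 0 1))
                (complex.Re (H 0 0 - H 1 1) / 2) in
  (t + Num.sqrt (t ^+ 2 - sqnorm x))^-1 *: x.

Definition ball_act_mx A (x : 'rV[R]_3) : 'rV[R]_3 :=
  ball_of_hermitian (A *m hermitian_of_ball x *m (map_mx Num.conj A)^T).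

(* Independent of the choice of [repr g], see [ball_act_pi]. *)
Definition ball_act g : 'rV[R]_3 -> 'rV[R]_3 := ball_act_mx (val (repr g)).

Lemma ball_act_pi (A : SL2 R) :
  ball_act (\pi_(PSL2 R) A) = ball_act_mx (val A).
Proof.
rewrite /ball_act; case: (repr_PSL2P A) => -> //=.
apply/funext => x; rewrite /ball_act_mx map_mxN linearN.
by rewrite mulNmx mulmxN mulNmx opprK.
Qed.

Lemma sqnorm_vec3 (a b c : R) : sqnorm (vec3 a b c) = a ^+ 2 + b ^+ 2 + c ^+ 2.
Proof. by rewrite /sqnorm !big_ord_recr big_ord0 /= !mxE /= add0r. Qed.

Lemma scale_vec3 (k a b c : R) : k *: vec3 a b c = vec3 (k * a) (k * b) (k * c).
Proof. by apply/rowP => i; rewrite !mxE; case: i => [[|[|[|//]]] ?]. Qed.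

Lemma ball_of_hermitian_rank1 (k u1 u2 v1 v2 : R) :
  0 < k -> 0 < u1 ^+ 2 + u2 ^+ 2 + (v1 ^+ 2 + v2 ^+ 2) ->
  ball_of_hermitian
    (mx2 (k * (u1 ^+ 2 + u2 ^+ 2))%:C
         ((k * (u1 * v1 + u2 * v2)) +i* (k * (u2 * v1 - u1 * v2)))
         ((k * (u1 * v1 + u2 * v2)) -i* (k * (u2 * v1 - u1 * v2)))
         (k * (v1 ^+ 2 + v2 ^+ 2))%:C)
  = stereo (homog (u1 +i* u2) (v1 +i* v2)).
Proof.
move=> k0 n0; rewrite /ball_of_hermitian !mxE /=.
rewrite sqnorm_vec3.
rewrite (_ : _ ^+ 2 - _ = 0); last by field.
rewrite sqrtr0 addr0 scale_vec3 /homog.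
rewrite eq_complex /=.
case: ifP n0 => [/andP[/eqP-> /eqP->]|v0] n0 /=.
  have u0 : 0 < u1^+2 + u2^+2 by move: n0; rewrite expr0n /= !addr0.
  congr vec3.
  - by ring.
  - by ring.
  - field; rewrite ?expr0n /= ?addr0 ?andbT.
    by rewrite ?mulf_neq0 ?gt_eqF.
have w0 : 0 < v1^+2 + v2^+2.
  rewrite lt_def addr_ge0 ?sqr_ge0// andbT paddr_eq0 ?sqr_ge0//.
  by rewrite !sqrf_eq0 v0.
have e1 : (v1^+2 + v2^+2) != 0 by rewrite gt_eqF.
have e2 : u1^+2 + u2^+2 + (v1^+2 + v2^+2) != 0 by rewrite gt_eqF.
have e3 : k != 0 by rewrite gt_eqF.
have e4 :
  (u1 * (v1 / (v1 ^+ 2 + v2 ^+ 2)) - u2 * - (v2 / (v1 ^+ 2 + v2 ^+ 2))) ^+ 2 +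
  (u1 * - (v2 / (v1 ^+ 2 + v2 ^+ 2)) + u2 * (v1 / (v1 ^+ 2 + v2 ^+ 2))) ^+ 2
  = (u1 ^+ 2 + u2 ^+ 2) / (v1 ^+ 2 + v2 ^+ 2).
  by field.
rewrite e4 scale_vec3.
have e5 : (u1 ^+ 2 + u2 ^+ 2) / (v1 ^+ 2 + v2 ^+ 2) + 1 =
  (u1 ^+ 2 + u2 ^+ 2 + (v1 ^+ 2 + v2 ^+ 2)) / (v1 ^+ 2 + v2 ^+ 2) by field.
rewrite e5; congr vec3; field;
  rewrite ?e1 ?e2 ?e3 ?mulf_neq0// -mulrDr; by rewrite ?mulf_neq0 ?e2 ?e3.
Qed.

Definition colvec2 (u v : R[i]) : 'cV[R[i]]_2 := \col_i [:: u; v]`_i.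
Definition outer (u v : R[i]) : 'M[R[i]]_2 :=
  colvec2 u v *m (map_mx Num.conj (colvec2 u v))^T.

Lemma ball_of_hermitian_outer (k : R) u v : 0 < k -> (u != 0) || (v != 0) ->
  ball_of_hermitian (k%:C *: outer u v) = stereo (homog u v).
Proof.
case: u v => [u1 u2] [v1 v2] k0 n0.
rewrite -(@ball_of_hermitian_rank1 k)//; last first.
  rewrite lt_def !addr_ge0 ?sqr_ge0// andbT !paddr_eq0 ?addr_ge0 ?sqr_ge0//.
  by move: n0; rewrite !sqrf_eq0 !eq_complex /= -negb_and.
congr ball_of_hermitian; apply/matrixP => i j.
rewrite !mxE big_ord1 !mxE.
case: i => [[|[|//]] ?]; case: j => [[|[|//]] ?] /=; apply/eqP;
  rewrite eq_complex /=; apply/andP; split; apply/eqP; ring.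
Qed.

Lemma hermitian_of_stereo_fin x y : exists2 k : R, 0 < k &
  hermitian_of_ball (stereo (Some (x +i* y))) = k%:C *: outer (x +i* y) 1.
Proof.
have n0 : 0 < x ^+ 2 + y ^+ 2 + 1 by rewrite ltr_wpDl ?addr_ge0 ?sqr_ge0.
have n1 : x ^+ 2 + y ^+ 2 + 1 != 0 by rewrite gt_eqF.
exists (4 / (x ^+ 2 + y ^+ 2 + 1)); first by rewrite divr_gt0.
rewrite /hermitian_of_ball /= scale_vec3 sqnorm_vec3 !mxE /=.
apply/matrixP => i j; rewrite !mxE big_ord1 !mxE.
case: i => [[|[|//]] ?]; case: j => [[|[|//]] ?] /=; apply/eqP;
  rewrite eq_complex /=; apply/andP; split; apply/eqP; by field.
Qed.

Lemma hermitian_of_stereo_inf :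
  hermitian_of_ball (stereo (None : riemann_sphere R)) = 4%:C *: outer 1 0.
Proof.
rewrite /hermitian_of_ball /= sqnorm_vec3 !mxE /=.
apply/matrixP => i j; rewrite !mxE big_ord1 !mxE.
case: i => [[|[|//]] ?]; case: j => [[|[|//]] ?] /=; apply/eqP;
  rewrite eq_complex /=; apply/andP; split; apply/eqP; by field.
Qed.

Lemma conj_outer (A : 'M[R[i]]_2) u v (k : R) :
  A *m (k%:C *: outer u v) *m (map_mx Num.conj A)^T =
  k%:C *: outer (A 0 0 * u + A 0 1 * v) (A 1 0 * u + A 1 1 * v).
Proof.
rewrite -scalemxAr -scalemxAl; congr (_ *: _); rewrite /outer.
have -> : colvec2 (A 0 0 * u + A 0 1 * v) (A 1 0 * u + A 1 1 * v) =
    A *m colvec2 u v.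
  apply/colP => i; rewrite !mxE !big_ord_recr big_ord0 /= !mxE /= add0r.
  by case: i => [[|[|//]] ?] /=; congr (A _ _ * _ + A _ _ * _); apply/val_inj.
by rewrite map_mxM trmx_mul !mulmxA.
Qed.

Lemma det_mx22 (A : 'M[R[i]]_2) : \det A = A 0 0 * A 1 1 - A 0 1 * A 1 0.
Proof.
rewrite (expand_det_row _ 0) !big_ord_recr big_ord0 /= /cofactor.
rewrite !det_mx11 !mxE /= add0r.
rewrite expr0 expr1 mul1r mulN1r mulrN.
by congr (A _ _ * A _ _ - A _ _ * A _ _); apply/val_inj.
Qed.

Lemma ball_act_stereo (g : PSL2 R) z :
  ball_act g (stereo z) = stereo (moebius g z).
Proof.
rewrite /ball_act /moebius; move: (repr g) => A.
have dA := det_SL2 A; move: (val A) dA => {}A; rewrite det_mx22 => dA.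
rewrite /ball_act_mx.
case: z => [[x y]|].
  have [k k0 ->] := hermitian_of_stereo_fin x y.
  rewrite conj_outer ball_of_hermitian_outer//; first by rewrite /homog /= !mulr1.
  rewrite -negb_and; apply/negP => /andP[/eqP e1 /eqP e2].
  have : 1 = 0 :> R[i]; last by apply/eqP; rewrite oner_eq0.
  transitivity (A 0 0 * (A 1 0 * (x +i* y) + A 1 1 * 1) -
                A 1 0 * (A 0 0 * (x +i* y) + A 0 1 * 1)).
    by rewrite -[LHS]dA; ring.
  by rewrite e1 e2 !mulr0 subrr.
rewrite hermitian_of_stereo_inf conj_outer ball_of_hermitian_outer//;
  first by rewrite /homog /= !mulr1 !mulr0 !addr0.
rewrite -negb_and; apply/negP => /andP[/eqP + /eqP].
rewrite !mulr1 !mulr0 !addr0 => e1 e2; move: dA; rewrite e1 e2 mul0r mulr0 subrr.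
by move/eqP; rewrite eq_sym oner_eq0.
Qed.

(* The accumulation points are taken in R^3 and may a priori depend on [p]. *)
Definition limit_set (p : 'rV[R]_3) (G : set (PSL2 R)) :
    set (riemann_sphere R) :=
  [set z | limit_point [set ball_act g p | g in G] (stereo z)].

Definition subgroup (G : set (PSL2 R)) : Prop := group_closed [in G].

Definition generated_subgroup (S : set (PSL2 R)) : set (PSL2 R) :=
  smallest subgroup S.

End moebius.

Definition discrete_subset (T : topologicalType) (A : set T) : Prop :=
  A `<=` isolated A.

Definition boundary (T : topologicalType) (A : set T) : set T :=
  closure A `\` A°.

Definition simple_closed_curve (R : realType) (T : topologicalType)
    (C : set T) : Prop :=
  exists f : R -> T,
    [/\ {within `[0, 1], continuous f}, f 0 = f 1,
        {in `[0, 1[ &, injective f} & C = f @` `[0, 1]].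

Section piecewise_conformal.
Variables (R : realType) (M : nat).
Variables (P : 'I_M -> set (riemann_sphere R)).
Variable F : riemann_sphere R -> riemann_sphere R.

Definition piecewise_conformal : Prop :=
  [/\ trivIset setT P,
      \bigcup_m P m = setT,
      forall m, (P m)° !=set0,
      forall m, exists (k : nat) (C : 'I_k -> set (riemann_sphere R)),
        (forall i, simple_closed_curve R (C i)) /\
        boundary (P m) = \bigcup_i C i
    & forall m, exists g : PSL2 R, forall z, P m z -> F z = moebius g z].

(* Since [P m] has nonempty interior, it contributes exactly one generator. *)
Definition Gamma : set (PSL2 R) :=
  generated_subgroup
    [set g | exists m, forall z, P m z -> F z = moebius g z].

End piecewise_conformal.

(* Accumulation points of the set of iterates, not cluster points of the
   sequence: a periodic orbit has an empty omega-limit. *)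
Definition omega_limit (T : topologicalType) (F : T -> T) (z : T) : set T :=
  limit_point [set iter n F z | n in [set: nat]].

(* Main.v *)
Require Import Defs.
From mathcomp Require Import all_boot all_order all_algebra.
From mathcomp Require Import all_classical all_reals all_analysis.
From mathcomp Require Import complex ring lra.
Set Implicit Arguments.
Unset Strict Implicit.
Unset Printing Implicit Defensive.
Import Order.TTheory GRing.Theory Num.Theory.
Import numFieldNormedType.Exports.
Local Open Scope classical_set_scope.
Local Open Scope quotient_scope.
Local Open Scope ring_scope.
Local Open Scope complex_scope.

(** A matrix [C] of determinant 1 determines the point [frame_point C] of the
    ball, the image of the center under [C], whose Hermitian form is [C C^*].
    Everything rests on one formula for its Euclidean distance to a boundary
    point, the one with homogeneous coordinates [v] (lemma [dist_frame_point]):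

      |stereo [v] - C.0|^2 = 4 |C^-1 v|^2 / (|v|^2 (|C|^2 + 2)),

    where [|C|] is the Frobenius norm. The action on the ball is transitive
    ([ball_frame]), so that the base point is [B.0] for some [B], and its image
    under [A] is [AB.0].

    Since each branch of [F] is a generator, [F^n z = g z] for some [g] in the
    group [G]. Let [w] be an accumulation point of the [F^n z].

    If [z] is in the limit set, then so are all [g z]: by the formula, the
    distance from [A v] to [AD.0] is at most a constant depending on [A] times
    the distance from [v] to [D.0]. The limit set is closed, hence contains [w].

    If [z] is not in the limit set, the points [A^-1 B.0], for [A] in [G], stay
    at a squared distance at least [d > 0] from [z]. The formula for [A^-1 B]
    bounds [|A v| / |v|] from below, and then the formula for [AB] gives

      |g z - AB.0|^2 <= 8 |B|^4 / (d (|AB|^2 + 2)).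

    As [G] is discrete, only finitely many of its elements have [|A|] below a
    given bound ([discrete_finite]), and they move [z] to finitely many points;
    points [F^n z] close enough to [w] and distinct from it are therefore [g z]
    with [|AB|] large, and are close to the orbit point [AB.0]. So [w] is a
    limit point of the orbit of the base point ([accumulation_limit_set]). *)

(** * Frobenius norm of complex matrices of size 2 *)

Section frobenius.
Variable R : realType.
Implicit Types (x y z : R[i]).

(** The norm of [R[i]] has values in [R[i]]; this is its square, as a real
    number, which makes inequalities accessible to real arithmetic. *)
Definition abs2 z : R := complex.Re z ^+ 2 + complex.Im z ^+ 2.

Lemma abs2_ge0 z : 0 <= abs2 z.
Proof. by rewrite addr_ge0 ?sqr_ge0. Qed.

Lemma abs2_eq0 z : (abs2 z == 0) = (z == 0).
Proof. by rewrite paddr_eq0 ?sqr_ge0// !sqrf_eq0 eq_complex. Qed.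

Lemma abs2N z : abs2 (- z) = abs2 z.
Proof. by case: z => a b; rewrite /abs2 /= !sqrrN. Qed.

Lemma abs2_cauchy_schwarz x y u v :
  abs2 (x * u + y * v) <= (abs2 x + abs2 y) * (abs2 u + abs2 v).
Proof.
(* Lagrange's identity. *)
rewrite -subr_ge0 [X in 0 <= X](_ : _ = abs2 (x * v^* - y * u^*)) ?abs2_ge0//.
case: x y u v => [a b] [c d] [e f] [g h]; rewrite /abs2 /=; ring.
Qed.

(** Square of the Frobenius norm. *)
Definition frob2 m n (A : 'M[R[i]]_(m, n)) : R := \sum_i \sum_j abs2 (A i j).

Lemma frob2_ge0 m n (A : 'M[R[i]]_(m, n)) : 0 <= frob2 A.
Proof. by do 2 apply: sumr_ge0 => ? _; rewrite abs2_ge0. Qed.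

Lemma abs2_le_frob2 m n (A : 'M[R[i]]_(m, n)) i j : abs2 (A i j) <= frob2 A.
Proof.
rewrite /frob2 (bigD1 i)//= (bigD1 j)//= -addrA lerDl addr_ge0//.
  by apply: sumr_ge0 => ? _; rewrite abs2_ge0.
by do 2 apply: sumr_ge0 => ? _; rewrite abs2_ge0.
Qed.

Lemma frob2_gt0 m n (A : 'M[R[i]]_(m, n)) : A != 0 -> 0 < frob2 A.
Proof.
move=> A0; rewrite lt_def frob2_ge0 andbT; apply: contra A0 => /eqP A0.
apply/eqP/matrixP => i j; rewrite mxE; apply/eqP; rewrite -abs2_eq0 eq_le.
by rewrite abs2_ge0 andbT -A0 abs2_le_frob2.
Qed.

Lemma ord2_ind (P : 'I_2 -> Prop) : P 0 -> P 1 -> forall i, P i.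
Proof.
move=> P0 P1 i; have [->//|->//] : i = 0 \/ i = 1.
by case: i => [[|[|//]] ?]; [left|right]; exact: val_inj.
Qed.

Lemma big_ord2 (V : nmodType) (f : 'I_2 -> V) : \sum_i f i = f 0 + f 1.
Proof.
by rewrite !big_ord_recr big_ord0 /= add0r; congr (f _ + f _); exact: val_inj.
Qed.

Lemma mulmx2E m n (A : 'M[R[i]]_(m, 2)) (B : 'M[R[i]]_(2, n)) i j :
  (A *m B) i j = A i 0 * B 0 j + A i 1 * B 1 j.
Proof. by rewrite mxE big_ord2. Qed.

(** Cauchy-Schwarz, entry by entry. *)
Lemma frob2_mulmx m n (A : 'M[R[i]]_(m, 2)) (B : 'M[R[i]]_(2, n)) :
  frob2 (A *m B) <= frob2 A * frob2 B.
Proof.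
rewrite {2}/frob2 mulr_suml; apply: ler_sum => i _.
rewrite /frob2 exchange_big/= mulr_sumr; apply: ler_sum => j _.
by rewrite mulmx2E !big_ord2 abs2_cauchy_schwarz.
Qed.

Lemma frob2_mxE (A : 'M[R[i]]_2) :
  frob2 A = abs2 (A 0 0) + abs2 (A 0 1) + (abs2 (A 1 0) + abs2 (A 1 1)).
Proof. by rewrite /frob2 !big_ord2. Qed.

Lemma frob2_colE (v : 'cV[R[i]]_2) : frob2 v = abs2 (v 0 0) + abs2 (v 1 0).
Proof. by rewrite /frob2 big_ord2 !big_ord1. Qed.

Lemma invmx_det1 (A : 'M[R[i]]_2) : \det A = 1 ->
  invmx A = mx2 (A 1 1) (- A 0 1) (- A 1 0) (A 0 0).
Proof.
move=> dA; have uA : A \in unitmx by rewrite unitmxE dA unitr1.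
apply: (can_inj (mulKmx uA)); rewrite mulmxV//.
rewrite det_mx22 in dA.
apply/matrixP; elim/ord2_ind; elim/ord2_ind; rewrite mulmx2E !mxE /= -?dA; ring.
Qed.

(** In size 2 the inverse permutes the entries up to sign, so that the norm of
    an element of SL2 also bounds how much it can shrink vectors. *)
Lemma frob2_invmx (A : 'M[R[i]]_2) : \det A = 1 -> frob2 (invmx A) = frob2 A.
Proof.
move=> dA; rewrite invmx_det1// !frob2_mxE !mxE /= !abs2N; ring.
Qed.

End frobenius.

(** * Homogeneous coordinates on the sphere *)

Section projective.
Variable R : realType.
Implicit Types (v : 'cV[R[i]]_2) (A C : 'M[R[i]]_2).

Definition sphere_point v : riemann_sphere R := homog (v 0 0) (v 1 0).

Lemma sphere_point_surj (z : riemann_sphere R) :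
  exists2 v, v != 0 & z = sphere_point v.
Proof.
case: z => [z|].
  exists (colvec2 z 1); last by rewrite /sphere_point !mxE /= /homog oner_eq0 divr1.
  by apply/eqP => /colP/(_ 1); rewrite !mxE /= => /eqP; rewrite oner_eq0.
exists (colvec2 1 0); last by rewrite /sphere_point !mxE /= /homog eqxx.
by apply/eqP => /colP/(_ 0); rewrite !mxE /= => /eqP; rewrite oner_eq0.
Qed.

Lemma moebius_mx_sphere_point A v : A \in unitmx -> v != 0 ->
  moebius_mx A (sphere_point v) = sphere_point (A *m v).
Proof.
move=> uA v0; rewrite /sphere_point !mulmx2E {1}/homog.
have [v1|v1] := eqVneq (v 1 0) 0.
  have u0 : v 0 0 != 0.
    apply: contra v0 => /eqP u0; apply/eqP/colP.
    by elim/ord2_ind; rewrite mxE.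
  rewrite /= v1 !mulr0 !addr0 /homog mulf_eq0 (negbTE u0) orbF.
  by case: ifPn => // A10; congr Some; field; rewrite u0 A10.
rewrite /= /homog.
have e i : A i 0 * (v 0 0 / v 1 0) + A i 1 = (A i 0 * v 0 0 + A i 1 * v 1 0) / v 1 0.
  by field.
rewrite !e mulf_eq0 invr_eq0 (negbTE v1) orbF.
by case: ifPn => // d0; congr Some; field; rewrite v1 d0.
Qed.

Lemma mulmx_neq0 A v : A \in unitmx -> v != 0 -> A *m v != 0.
Proof.
move=> uA; apply: contra => /eqP e; apply/eqP.
by apply: (can_inj (mulKmx uA)); rewrite e mulmx0.
Qed.

End projective.

(** * Images of the center of the ball *)

Section ball_orbit.
Variable R : realType.
Implicit Types (v : 'cV[R[i]]_2) (A C : 'M[R[i]]_2) (p : 'rV[R]_3).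

(** The center of the ball has the identity as Hermitian form, which [C] maps to
    [C C^*]. *)
Definition frame_point C : 'rV[R]_3 :=
  ball_of_hermitian (C *m (map_mx Num.conj C)^T).

Lemma conjcE (z : R[i]) : Num.conj z = z^*%C.
Proof. by []. Qed.

Lemma sqnormE (x : 'rV[R]_3) : sqnorm x = x 0 0 ^+ 2 + x 0 1 ^+ 2 + x 0 2 ^+ 2.
Proof.
rewrite /sqnorm !big_ord_recr big_ord0 /= add0r.
by congr (x _ _ ^+ 2 + x _ _ ^+ 2 + x _ _ ^+ 2); exact: val_inj.
Qed.

(** Expanding the square, [y / s] has squared norm 1 and [x / (t + 1)] has
    squared norm [(t - 1) / (t + 1)], so that only the Minkowski product of the
    null vector [(s, y)] and the unit timelike vector [(t, x)] remains. *)
Lemma dist_null_timelike (s y1 y2 y3 t x1 x2 x3 : R) :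
  0 < s -> s ^+ 2 = y1 ^+ 2 + y2 ^+ 2 + y3 ^+ 2 ->
  0 < t + 1 -> t ^+ 2 - (x1 ^+ 2 + x2 ^+ 2 + x3 ^+ 2) = 1 ->
  sqnorm
    ((s + Num.sqrt (s ^+ 2 - (y1 ^+ 2 + y2 ^+ 2 + y3 ^+ 2)))^-1 *: vec3 y1 y2 y3
   - (t + Num.sqrt (t ^+ 2 - (x1 ^+ 2 + x2 ^+ 2 + x3 ^+ 2)))^-1
       *: vec3 x1 x2 x3) =
  2 * (s * t - (x1 * y1 + x2 * y2 + x3 * y3)) / (s * (t + 1)).
Proof.
move=> s0 sy t0 tx; rewrite tx -sy subrr sqrtr0 sqrtr1 addr0.
have [s1 t1] : s != 0 /\ t + 1 != 0 by rewrite !gt_eqF.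
rewrite !scale_vec3 -scaleN1r scale_vec3 sqnormE !mxE /= !mulN1r.
transitivity ((y1 ^+ 2 + y2 ^+ 2 + y3 ^+ 2) / s ^+ 2
   + (x1 ^+ 2 + x2 ^+ 2 + x3 ^+ 2) / (t + 1) ^+ 2
   - 2 * (x1 * y1 + x2 * y2 + x3 * y3) / (s * (t + 1))).
  by field; rewrite s1 t1.
rewrite -sy (_ : x1 ^+ 2 + _ + _ = t ^+ 2 - 1); last by rewrite -tx; ring.
by field; rewrite s1 t1.
Qed.

(** A boundary point is the null vector [v v^*] of trace [|v|^2], the image of
    the center is the unit timelike vector [C C^*] of trace [|C|^2], and the
    Minkowski product is invariant: that of [v v^*] and [C C^*] is that of
    [C^-1 v] and the identity, i.e., half of [|C^-1 v|^2]. *)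
Lemma dist_frame_point C v : \det C = 1 -> v != 0 ->
  sqnorm (stereo (sphere_point v) - frame_point C) =
  4 * frob2 (invmx C *m v) / (frob2 v * (frob2 C + 2)).
Proof.
move=> dC v0.
have nv : 0 < frob2 v := frob2_gt0 v0.
have nC : 0 < frob2 C + 2 by rewrite ltr_wpDl ?frob2_ge0.
have -> : stereo (sphere_point v) = ball_of_hermitian (outer (v 0 0) (v 1 0)).
  rewrite -[outer _ _]scale1r -[1]/(1%:C) ball_of_hermitian_outer//.
  by move: nv; rewrite frob2_colE; case: eqVneq => //= ->; case: eqVneq => // ->;
    rewrite /abs2 /= expr0n /= !addr0 ltxx.
move: nv nC; rewrite (invmx_det1 dC) !frob2_colE !mulmx2E !mxE /= frob2_mxE.
rewrite det_mx22 in dC.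
rewrite /frame_point /ball_of_hermitian /outer.
rewrite !mulmx2E !mxE !big_ord1 !mxE /= !conjcE.
(* In real coordinates both sides become explicit rational functions. *)
move: dC.
move: (v 0 0) (v 1 0) (C 0 0) (C 0 1) (C 1 0) (C 1 1).
move=> [u1 u2] [w1 w2] [a1 a2] [b1 b2] [c1 c2] [d1 d2] /=.
move=> /eqP; rewrite eq_complex /= => /andP[/eqP dr /eqP di].
rewrite !sqnorm_vec3 /abs2 /= => nv nC.
rewrite dist_null_timelike.
- by field; rewrite (gt_eqF nv) (gt_eqF nC).
- by rewrite divr_gt0 ?ltr0n//; move: nv; rewrite !expr2 !mulrN !opprK.
- by field.
- rewrite (_ : _ + 1 = (a1 ^+ 2 + a2 ^+ 2 + (b1 ^+ 2 + b2 ^+ 2) +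
    (c1 ^+ 2 + c2 ^+ 2 + (d1 ^+ 2 + d2 ^+ 2)) + 2) / 2); last by field.
  by rewrite divr_gt0 ?ltr0n.
- transitivity ((a1 * d1 - a2 * d2 - (b1 * c1 - b2 * c2)) ^+ 2 +
    (a1 * d2 + a2 * d1 - (b1 * c2 + b2 * c1)) ^+ 2).
    by field.
  by rewrite dr di expr0n addr0 expr1n.
Qed.

Lemma ball_of_hermitianZ (k : R) (H : 'M[R[i]]_2) : 0 < k ->
  ball_of_hermitian (k%:C *: H) = ball_of_hermitian H.
Proof.
move=> k0; rewrite /ball_of_hermitian !mxE.
move: (H 0 0) (H 0 1) (H 1 1) => [a1 a2] [b1 b2] [d1 d2] /=.
rewrite !sqnorm_vec3 !mul0r !subr0 ?addr0.
set t := (a1 + d1) / 2; set x3 := (a1 - d1) / 2.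
have -> : (k * a1 + k * d1) / 2 = k * t by rewrite /t; field.
have -> : (k * a1 - k * d1) / 2 = k * x3 by rewrite /x3; field.
rewrite -[vec3 (k * b1) _ _]scale_vec3 scalerA; congr (_ *: _).
rewrite (_ : _ - _ = k ^+ 2 * (t ^+ 2 - (b1 ^+ 2 + b2 ^+ 2 + x3 ^+ 2))); last by ring.
rewrite sqrtrM ?sqr_ge0// sqrtr_sqr gtr0_norm// -mulrDr invfM.
by rewrite mulrAC mulVf ?mul1r// gt_eqF.
Qed.

(** Transitivity of the action on the ball: the Hermitian form of [p] is positive
    definite of determinant [d ^+ 2], and its Cholesky factorization, with an
    upper triangular factor normalized to determinant 1, provides [B]. *)
Lemma ball_frame p : open_unit_ball p -> exists (B : SL2 R) (d : R), 0 < d /\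
  hermitian_of_ball p = d%:C *: (val B *m (map_mx Num.conj (val B))^T).
Proof.
rewrite /open_unit_ball /= => p1; set d : R := 1 - sqnorm p.
have d0 : 0 < d by rewrite subr_gt0.
set b1 := 2 * p 0 0; set b2 := 2 * p 0 1.
set a := 1 + sqnorm p + 2 * p 0 2; set c := 1 + sqnorm p - 2 * p 0 2.
have c0 : 0 < c.
  by move: p1; rewrite /c sqnormE => p1; nra.
have acd : a * c = d ^+ 2 + (b1 ^+ 2 + b2 ^+ 2).
  by rewrite /a /c /d /b1 /b2 sqnormE; ring.
set g : R := Num.sqrt (c / d).
have g0 : 0 < g by rewrite sqrtr_gt0 divr_gt0.
have gg : g ^+ 2 = c / d by rewrite sqr_sqrtr// ltW// divr_gt0.
pose B := mx2 g^-1%:C ((b1 / (d * g)) +i* (b2 / (d * g))) 0 g%:C.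
have dB : \det B == 1.
  rewrite det_mx22 !mxE /= mulr0 subr0; apply/eqP/eqP; rewrite eq_complex /=.
  by rewrite !mul0r !mulr0 subr0 addr0 mulVf ?eqxx ?gt_eqF.
exists (Sub B dB), d; split=> //=; apply/matrixP.
have [g1 d1 c1] : [/\ g != 0, d != 0 & c != 0] by rewrite !gt_eqF.
elim/ord2_ind; elim/ord2_ind; rewrite [RHS]mxE mulmx2E !mxE /= -/b1 -/b2 -/a -/c.
all: apply/eqP; rewrite eq_complex /=; apply/andP; split; apply/eqP.
all: rewrite ?(mulr0, mul0r, addr0, add0r, subr0, oppr0) //.
- transitivity ((d ^+ 2 + (b1 ^+ 2 + b2 ^+ 2)) / (d * g ^+ 2)); last by field; rewrite g1 d1.
  by rewrite gg -acd; field; rewrite d1 c1.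
- by ring.
- by field; rewrite g1 d1.
- by field; rewrite g1 d1.
- by field; rewrite g1 d1.
- by field; rewrite g1 d1.
- by rewrite -expr2 gg; field.
Qed.

Lemma ball_act_frame_point p (B : SL2 R) (d : R) : 0 < d ->
  hermitian_of_ball p = d%:C *: (val B *m (map_mx Num.conj (val B))^T) ->
  forall A : SL2 R, ball_act (\pi_(PSL2 R) A) p = frame_point (val (A * B)%g).
Proof.
move=> d0 pB A; rewrite ball_act_pi /ball_act_mx pB /frame_point.
rewrite -scalemxAr -scalemxAl ball_of_hermitianZ//=.
by rewrite map_mxM trmx_mul !mulmxA.
Qed.

End ball_orbit.

(** * Chordal distance on the sphere *)

Section chordal.
Variable R : realType.
Implicit Types (z w : R[i]).

Lemma dist_stereo z w : sqnorm (stereo (Some z) - stereo (Some w)) =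
  4 * abs2 (z - w) / ((1 + abs2 z) * (1 + abs2 w)).
Proof.
have n0 (x : R[i]) : 1 + abs2 x != 0 by rewrite gt_eqF// ltr_wpDr ?abs2_ge0.
have := n0 z; have := n0 w; case: z w => [a b] [c d]; rewrite /abs2 /=.
move=> n1 n2; rewrite !scale_vec3 sqnormE !mxE /=.
by field; rewrite n1 n2.
Qed.

Lemma dist_stereo_inf z :
  sqnorm (stereo (Some z) - stereo None) = 4 / (1 + abs2 z).
Proof.
have : 1 + abs2 z != 0 by rewrite gt_eqF// ltr_wpDr ?abs2_ge0.
case: z => [a b]; rewrite /abs2 /= => n1; rewrite scale_vec3 sqnormE !mxE /=.
by field.
Qed.

Lemma sqnorm_ge0 (x : 'rV[R]_3) : 0 <= sqnorm x.
Proof. by apply: sumr_ge0 => i _; rewrite sqr_ge0. Qed.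

Lemma sqnorm_eq0 (x : 'rV[R]_3) : sqnorm x = 0 -> x = 0.
Proof.
move=> x0; apply/rowP => i; rewrite mxE; apply/eqP; rewrite -sqrf_eq0.
by move/eqP: x0; rewrite psumr_eq0 => [/allP/(_ i (mem_index_enum _))//|j _];
  rewrite sqr_ge0.
Qed.

Lemma sqnormN (x : 'rV[R]_3) : sqnorm (- x) = sqnorm x.
Proof. by rewrite !sqnormE !mxE !sqrrN. Qed.

Lemma stereo_inj : injective (@stereo R).
Proof.
have d0 (x : R[i]) : 0 < 1 + abs2 x by rewrite ltr_wpDr ?abs2_ge0.
have inf z : stereo (Some z) <> stereo None.
  move=> e; have := dist_stereo_inf z; rewrite e subrr => /eqP.
  rewrite sqnormE !mxE !expr0n !addr0 eq_sym.
  by apply/negP; rewrite mulf_neq0 ?invr_eq0 ?gt_eqF ?ltr0n.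
move=> [z|] [w|] //= e; [|by have := inf z e|by have := inf w (esym e)].
have nz : 4 / ((1 + abs2 z) * (1 + abs2 w)) != 0.
  by rewrite mulf_neq0 ?invr_eq0 ?mulf_neq0 ?gt_eqF ?ltr0n.
have := dist_stereo z w; rewrite /stereo e subrr sqnormE !mxE !expr0n !addr0.
move=> /esym/eqP; rewrite mulrAC mulf_eq0 (negbTE nz)/= abs2_eq0 subr_eq0.
by move/eqP->.
Qed.

(** Parallelogram law in lieu of the triangle inequality. *)
Lemma sqnorm_triangle (x y z : 'rV[R]_3) :
  sqnorm (x - z) <= 2 * sqnorm (x - y) + 2 * sqnorm (y - z).
Proof.
rewrite !mulr_sumr -big_split/=; apply: ler_sum => i _; rewrite !mxE.
move: (x 0 i) (y 0 i) (z 0 i) => a b c.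
have -> : a - c = (a - b) + (b - c) by ring.
by rewrite -subr_ge0 [X in 0 <= X](_ : _ = (a - b - (b - c)) ^+ 2) ?sqr_ge0//; ring.
Qed.

Lemma nbhs_sqnormP (x : 'rV[R]_3) (U : set 'rV[R]_3) :
  nbhs x U <-> exists2 e, 0 < e & forall y, sqnorm (y - x) < e -> U y.
Proof.
split=> [/nbhs_ballP[e /= e0 eU]|[e e0 eU]].
  exists (e ^+ 2); first by rewrite exprn_gt0.
  move=> y xy; apply: eU; split=> // i j; rewrite (ord1 i) /ball /= distrC.
  rewrite -(@ltr_pXn2r _ 2)// ?nnegrE ?normr_ge0 ?(ltW e0)//.
  apply: le_lt_trans xy; rewrite -normrX ger0_norm ?sqr_ge0//.
  rewrite /sqnorm (bigD1 j)//= !mxE lerDl.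
  by apply: sumr_ge0 => k _; rewrite sqr_ge0.
apply/nbhs_ballP; exists (Num.min 1 (e / 3)) => /=.
  by rewrite lt_min ltr01 divr_gt0.
move=> y [_ xy]; apply: eU.
have lt i : (y - x) 0 i ^+ 2 < e / 3.
  have := xy 0 i; rewrite /ball /= distrC lt_min => /andP[l1 l2].
  rewrite !mxE; set t := y 0 i - x 0 i in l1 l2 *.
  rewrite -real_normK ?num_real// expr2 (le_lt_trans _ l2)//.
  by rewrite ler_piMl// ltW.
have := lt 0; have := lt 1; have := lt 2; rewrite sqnormE => l1 l2 l3; lra.
Qed.

End chordal.

(** * Continuity of the stereographic projection *)

Section complex_topology.
Variable R : realType.
Implicit Types (z w : R[i]).

Lemma normc_lt z (e : R) : 0 < e -> (`|z| < (Num.sqrt e)%:C) = (abs2 z < e).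
Proof. by move=> e0; rewrite normc_def ltcR ltr_sqrt. Qed.

Lemma nbhs_abs2 z (U : set R[i]) :
  nbhs z U <-> exists2 e, 0 < e & forall w, abs2 (w - z) < e -> U w.
Proof.
split=> [/nbhs_ballP[[e e'] /= + eU]|[e e0 eU]].
  rewrite ltcE /= => /andP[/eqP e'0 e0]; exists (e ^+ 2); first by rewrite exprn_gt0.
  move=> w zw; apply: eU; rewrite /ball /= distrC e'0.
  by rewrite -[e]gtr0_norm// -sqrtr_sqr normc_lt// exprn_gt0.
apply/nbhs_ballP; exists (Num.sqrt e)%:C => /=; first by rewrite ltcR sqrtr_gt0.
by move=> w; rewrite /ball /= distrC normc_lt// => /eU.
Qed.

Lemma continuous_Complex : continuous (fun x : R * R => x.1 +i* x.2 : R[i]).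
Proof.
move=> x U /nbhs_abs2[e e0 eU]; rewrite nbhs_simpl/=.
have e2 : 0 < e / 2 by rewrite divr_gt0.
apply/nbhs_ballP; exists (Num.sqrt (e / 2)) => /=; first by rewrite sqrtr_gt0.
move=> y [/= + +]; rewrite /ball /= distrC => h1; rewrite distrC => h2; apply: eU.
have h (a : R) : `|a| < Num.sqrt (e / 2) -> a ^+ 2 < e / 2.
  by rewrite -sqrtr_sqr ltr_sqrt.
by have := h _ h1; have := h _ h2; rewrite /abs2 /=; lra.
Qed.

(** These squares are cofinal among the compact sets whose complements are the
    neighborhoods of infinity. *)
Lemma compact_square (r : R) : compact [set z : R[i] |
  (- r <= complex.Re z <= r) && (- r <= complex.Im z <= r)].
Proof.
have -> : [set z : R[i] | (- r <= complex.Re z <= r) && (- r <= complex.Im z <= r)] =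
    (fun x : R * R => x.1 +i* x.2) @` (`[- r, r] `*` `[- r, r]).
  apply/seteqP; split=> [[a b] /= /andP[ha hb]|_ [[a b] [/= ha hb] <-]] /=.
    by exists (a, b) => //; split; rewrite /= in_itv.
  by move: ha hb; rewrite !in_itv /= => -> ->.
apply: continuous_compact; last by apply: compact_setX; exact: segment_compact.
by apply: continuous_subspaceT; exact: continuous_Complex.
Qed.

(** Continuity of the projection, by the chordal distance formulas. At infinity,
    it amounts to the compactness of large squares. *)
Lemma nbhs_stereo (z : riemann_sphere R) (e : R) : 0 < e ->
  nbhs z [set w | sqnorm (stereo w - stereo z) < e].
Proof.
move=> e0; case: z => [z|].
  apply/nbhs_abs2; exists (e / 4); first by rewrite divr_gt0.
  move=> w zw /=; rewrite dist_stereo ltr_pdivrMr; last first.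
    by rewrite mulr_gt0// ltr_wpDr ?abs2_ge0.
  apply: (@lt_le_trans _ _ e); first by rewrite mulrC -ltr_pdivlMr.
  rewrite ler_peMr ?(ltW e0)//.
  by have := abs2_ge0 z; have := abs2_ge0 w; nra.
(* Outside the square of radius [r] one has [abs2 w >= r], as [r >= 1], and
   the distance to infinity is [4 / (1 + abs2 w)]. *)
pose r : R := 1 + 4 / e.
have r0 : 0 < 4 / e by rewrite divr_gt0.
exists [set z : R[i] | (- r <= complex.Re z <= r) && (- r <= complex.Im z <= r)].
  split; first exact: compact_square.
  by apply: compact_closed; [exact: (@norm_hausdorff _ (R[i] : numFieldType))|exact: compact_square].
move=> _ [[w /= wr <-]|-> /=]; last first.
  by rewrite subrr sqnormE !mxE expr0n !addr0.
rewrite dist_stereo_inf ltr_pdivrMr; last by rewrite ltr_wpDr ?abs2_ge0.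
have rw : r <= abs2 w.
  rewrite leNgt; apply/negP => wr'; apply: wr; move: wr'; rewrite /abs2.
  set a := complex.Re w; set b := complex.Im w => ab.
  have r1 : 1 < r by rewrite ltrDl.
  by apply/andP; split; apply/andP; split; nra.
have -> : 4 = e * (4 / e) by field; rewrite gt_eqF.
by rewrite ltr_pM2l//; apply: lt_le_trans (lerD (lexx 1) rw); rewrite /r; lra.
Qed.
End complex_topology.

(** * Finiteness of bounded parts of discrete groups *)

Section discreteness.
Variable R : realType.
Implicit Types (G : set (PSL2 R)).

(** The isolation of the identity is transported to matrices by the continuity
    of the projection from SL2 to PSL2. *)
Lemma discrete_near_one G : G 1%g -> discrete_subset G ->
  exists2 e : R, 0 < e & forall A : SL2 R, G (\pi_(PSL2 R) A) ->
    frob2 (val A - 1%:M) < e -> \pi_(PSL2 R) A = 1%g.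
Proof.
move=> G1 /(_ _ G1)[_ [V V1 VG]].
have : nbhs (1%g : SL2 R) (fun A => V (\pi_(PSL2 R) A)).
  exact: (@pi_continuous (SL2 R) {eq_quot (@eq_up_to_sign_equiv_rel R)} 1%g V).
rewrite nbhsE => -[_ [[W oW <-] W1] WV].
have /nbhs_ballP[[e e'] /= + eW] : nbhs (1%:M : 'M[R[i]]_2) W.
  exact: open_nbhs_nbhs.
rewrite ltcE /= => /andP[/eqP e'0 e0]; rewrite {e'}e'0 in eW.
exists (e ^+ 2); first by rewrite exprn_gt0.
move=> A GA A1; have VA : V (\pi_(PSL2 R) A).
  apply: WV; apply: eW; split; first by rewrite ltcR.
  move=> i j; rewrite /ball /= distrC -[e]gtr0_norm// -sqrtr_sqr.
  rewrite normc_lt ?exprn_gt0//; apply: le_lt_trans A1.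
  by have := abs2_le_frob2 (val A - 1%:M) i j; rewrite !mxE.
have : (V `&` G) (\pi_(PSL2 R) A) by [].
by rewrite VG.
Qed.

Lemma truncn_eq_dist (x y : R) : 0 <= x -> 0 <= y ->
  Num.truncn x = Num.truncn y -> (x - y) ^+ 2 < 1.
Proof.
move=> /truncn_itv + /truncn_itv + e; rewrite e -natr1.
by move=> /andP[? ?] /andP[? ?]; nra.
Qed.

(** Total boundedness: a set of matrices of bounded norm whose points are
    uniformly separated is finite, since the cells of a fine enough grid each
    hold at most one of them. *)
Lemma separated_bounded_finite (T : choiceType) (S : set T)
    (f : T -> 'M[R[i]]_2) (K e : R) : 0 < e ->
  (forall x, S x -> frob2 (f x) <= K) ->
  (forall x y, S x -> S y -> frob2 (f x - f y) < e -> x = y) -> finite_set S.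
Proof.
move=> e0 SK Se.
(* [r] bounds the coordinates; [8 * h ^+ 2 <= e], with 8 real coordinates, makes
   matrices in the same cell of side [h] closer than [e]. *)
pose r := K + 1; pose h := Num.min 1 (e / 8).
have h0 : 0 < h by rewrite lt_min ltr01 divr_gt0.
have he : 8 * h ^+ 2 <= e.
  have h1 : h <= 1 by rewrite ge_min lexx.
  have h2 : h <= e / 8 by rewrite ge_min lexx orbT.
  by nra.
pose part (b : bool) (z : R[i]) := if b then complex.Re z else complex.Im z.
have shift_ge0 x b i j : S x -> 0 <= (part b (f x i j) + r) / h <= 2 * r / h.
  move=> Sx; have := le_trans (abs2_le_frob2 (f x) i j) (SK _ Sx).
  rewrite /r /abs2 /part; set a := complex.Re _; set c := complex.Im _.
  move=> ac; apply/andP; split; [rewrite divr_ge0 ?(ltW h0)//|rewrite ler_pM2r ?invr_gt0//].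
    by case: b; nra.
  by case: b; nra.
pose cell x := [ffun k : bool * ('I_2 * 'I_2) =>
  inord (Num.truncn ((part k.1 (f x k.2.1 k.2.2) + r) / h))
    : 'I_(Num.truncn (2 * r / h)).+1].
suff /inj_card_eq cellS : {in S &, injective cell}.
  by rewrite -(eq_finite_set cellS); exact: finite_finset.
move=> x y /set_mem Sx /set_mem Sy xy.
apply: Se => //.
have close b i j : (part b (f x i j) - part b (f y i j)) ^+ 2 < h ^+ 2.
  have /(congr1 val) := congr1 (fun g : {ffun _ -> _} => g (b, (i, j))) xy.
  have /andP[x1 x2] := shift_ge0 x b i j Sx.
  have /andP[y1 y2] := shift_ge0 y b i j Sy.
  rewrite !ffunE /= !inordK ?ltnS ?le_truncn// => /(truncn_eq_dist x1 y1).
  rewrite -mulrBl expr_div_n ltr_pdivrMr ?exprn_gt0// mul1r.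
  by rewrite opprD addrACA subrr addr0.
rewrite frob2_mxE !mxE.
have sub2 (u v : R[i]) : abs2 (u - v) =
    (part true u - part true v) ^+ 2 + (part false u - part false v) ^+ 2.
  by case: u v => [? ?] [? ?].
rewrite !sub2; apply: lt_le_trans he.
have := close true 0 0; have := close true 0 1.
have := close true 1 0; have := close true 1 1.
have := close false 0 0; have := close false 0 1.
have := close false 1 0; have := close false 1 1.
lra.
Qed.

(** Since [A B^-1 - 1 = (A - B) B^-1], two close elements of bounded norm have
    a quotient close to the identity: the isolation of the identity separates
    uniformly all elements of bounded norm. *)
Lemma discrete_finite G (K : R) : subgroup G -> discrete_subset G ->
  finite_set [set g | G g /\ frob2 (val (repr g)) <= K].
Proof.
move=> sG dG; have G1 : G 1%g by have [/set_mem] := sG.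
have [e e0 eG] := discrete_near_one G1 dG.
have K1 : 0 < Num.max 1 K by rewrite lt_max ltr01.
apply: (@separated_bounded_finite (PSL2 R) _ (fun g => val (repr g)) K
  (e / Num.max 1 K)); first by rewrite divr_gt0.
  by move=> g [].
move=> g h [Gg gK] [Gh hK]; rewrite ltr_pdivlMr// => gh.
have pE : (g / h)%g = \pi_(PSL2 R) (repr g / repr h)%g.
  by rewrite -PSL2_mulE -PSL2_invE !reprK.
apply/eqP; rewrite -divg_eq1 pE; apply/eqP; apply: eG.
  by rewrite -pE; apply/set_mem; apply: sG.2; exact/mem_set.
rewrite /= (_ : _ - _ = (val (repr g) - val (repr h)) *m invmx (val (repr h))).
  apply: le_lt_trans (frob2_mulmx _ _) _; apply: le_lt_trans gh.
  by rewrite frob2_invmx ?det_SL2// ler_wpM2l ?frob2_ge0// le_max hK orbT.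
by rewrite mulmxBl mulmxV ?unitmx_SL2.
Qed.
End discreteness.

(** * Distance estimates along orbits *)

Section limit_sets.
Variable R : realType.
Implicit Types (G : set (PSL2 R)) (A B : SL2 R) (v : 'cV[R[i]]_2).
Implicit Types (g h : PSL2 R) (z w : riemann_sphere R).

Lemma moebius_sphere_point g v : v != 0 ->
  moebius g (sphere_point v) = sphere_point (val (repr g) *m v).
Proof. by move=> v0; rewrite /moebius moebius_mx_sphere_point ?unitmx_SL2. Qed.

Lemma moebius1 z : moebius 1%g z = z.
Proof.
have [v v0 ->] := sphere_point_surj z.
by rewrite moebius_pi moebius_mx_sphere_point ?unitmx1// mul1mx.
Qed.

Lemma moebiusM g h z : moebius (g * h)%g z = moebius g (moebius h z).
Proof.
have [v v0 ->] := sphere_point_surj z.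
have -> : (g * h)%g = \pi_(PSL2 R) (repr g * repr h)%g by [].
rewrite moebius_pi moebius_mx_sphere_point ?unitmx_SL2//.
by rewrite !moebius_sphere_point ?mulmx_neq0 ?unitmx_SL2//= mulmxA.
Qed.

Lemma frob2_SL2_gt0 A : 0 < frob2 (val A).
Proof.
apply: frob2_gt0; apply/eqP => A0; have := unitmx_SL2 A.
by rewrite A0 unitmxE det0 unitr0.
Qed.

Lemma invmxM (C D : 'M[R[i]]_2) : C \in unitmx -> D \in unitmx ->
  invmx (C *m D) = invmx D *m invmx C.
Proof.
move=> uC uD; have uCD : C *m D \in unitmx by rewrite unitmx_mul uC uD.
apply: (can_inj (mulKmx uCD)).
by rewrite mulmxV// mulmxA -(mulmxA C) mulmxV// mulmx1 mulmxV.
Qed.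

Lemma dist_frame_point_gt0 A z : 0 < sqnorm (stereo z - frame_point (val A)).
Proof.
have [v v0 ->] := sphere_point_surj z; rewrite dist_frame_point ?det_SL2//.
rewrite divr_gt0 ?mulr_gt0 ?frob2_gt0 ?mulmx_neq0 ?unitmx_inv ?unitmx_SL2//.
by rewrite ltr_wpDl ?frob2_ge0.
Qed.

(** The vector [(A B)^-1 (A v) = B^-1 v] does not depend on [A]: only the
    denominator changes along the orbit. *)
Lemma dist_frame_pointM A B v : v != 0 ->
  sqnorm (stereo (sphere_point (val A *m v)) - frame_point (val (A * B)%g)) =
  4 * frob2 (invmx (val B) *m v) /
    (frob2 (val A *m v) * (frob2 (val (A * B)%g) + 2)).
Proof.
move=> v0; rewrite dist_frame_point ?det_SL2 ?mulmx_neq0 ?unitmx_SL2//=.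
by rewrite invmxM ?unitmx_SL2// -mulmxA mulKmx ?unitmx_SL2.
Qed.

Lemma frob2_cancel m A (C : 'M[R[i]]_(2, m)) :
  frob2 C <= frob2 (val A) * frob2 (val A *m C).
Proof.
rewrite -{1}(mulKmx (unitmx_SL2 A) C); apply: le_trans (frob2_mulmx _ _) _.
by rewrite frob2_invmx ?det_SL2.
Qed.

Lemma frob2_cancelV m A (C : 'M[R[i]]_(2, m)) :
  frob2 (invmx (val A) *m C) <= frob2 (val A) * frob2 C.
Proof. by rewrite -(frob2_invmx (det_SL2 A)) frob2_mulmx. Qed.

(** Applying [A] divides [|v|] and [|B|] at most by [|A|], which bounds the loss
    in the denominator of the distance formula. *)
Lemma dist_frame_point_lipschitz A B v : v != 0 ->
  sqnorm (stereo (sphere_point (val A *m v)) - frame_point (val (A * B)%g)) <=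
  frob2 (val A) * (frob2 (val A) + 1) *
    sqnorm (stereo (sphere_point v) - frame_point (val B)).
Proof.
move=> v0; set a := frob2 (val A).
rewrite dist_frame_pointM// dist_frame_point ?det_SL2//.
have a0 : 0 < a := frob2_SL2_gt0 A.
have := frob2_cancel A v; have := frob2_cancel A (val B).
have := frob2_gt0 (mulmx_neq0 (unitmx_SL2 A) v0); have := frob2_gt0 v0.
rewrite -/a -[val (A * B)%g]/(val A *m val B).
have := frob2_ge0 (val A *m val B); have := frob2_ge0 (val B).
have := frob2_ge0 (invmx (val B) *m v).
move: (frob2 (invmx _ *m _)) (frob2 v) (frob2 (val A *m v)) => q n n'.
move: (frob2 (val A *m val B)) (frob2 (val B)) => s t.
move=> q0 t0 s0 n0 n'0 ts nn'.
have d0 : 0 < n * (t + 2) by rewrite mulr_gt0// ltr_wpDl.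
have d'0 : 0 < n' * (s + 2) by rewrite mulr_gt0// ltr_wpDl.
rewrite mulrA ler_pdivrMr// mulrAC ler_pdivlMr//.
rewrite [leRHS](_ : _ = 4 * q * ((a * n') * ((a + 1) * (s + 2)))); last by ring.
rewrite ler_wpM2l ?mulr_ge0// ler_pM ?(ltW n0) ?addr_ge0//; nra.
Qed.

(** The distance formula for [A^-1 B], with numerator
    [|B^-1 A v|^2 <= |B|^2 |A v|^2], turns the hypothesis into a lower bound on
    [|A v| / |v|], which is what the formula for [A B] requires to show that [A]
    sends the base point close to the image of [v] as soon as [|A B|] is large.
    *)
Lemma dist_frame_point_expansion A B v d : v != 0 -> 0 <= d ->
  d <= sqnorm (stereo (sphere_point v) - frame_point (val (A^-1 * B)%g)) ->
  d * (frob2 (val (A * B)%g) + 2) *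
    sqnorm (stereo (sphere_point (val A *m v)) - frame_point (val (A * B)%g))
  <= 8 * frob2 (val B) ^+ 2.
Proof.
move=> v0 d0; rewrite dist_frame_pointM//.
have u0 : val A *m v != 0 by rewrite mulmx_neq0 ?unitmx_SL2.
rewrite -[in sphere_point v](mulKmx (unitmx_SL2 A) v).
rewrite -[invmx (val A)]/(val A^-1%g) dist_frame_pointM//= mulKmx ?unitmx_SL2//.
have := frob2_cancelV B v; have := frob2_cancelV B (val A *m v).
have := frob2_gt0 v0; have := frob2_gt0 u0; have := frob2_SL2_gt0 B.
have := frob2_ge0 (invmx (val A) *m val B); have := frob2_ge0 (val A *m val B).
move: (frob2 (invmx (val B) *m v)) (frob2 (invmx _ *m (_ *m _))) => q q'.
move: (frob2 v) (frob2 (val A *m v)) (frob2 (val B)) => n n' b.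
move: (frob2 (val A *m val B)) (frob2 (invmx _ *m _)) => s t.
move=> s0 t0 b0 n'0 n0 qb q'b dq.
have s2 : 0 < s + 2 by rewrite ltr_wpDl.
have t2 : 0 < t + 2 by rewrite ltr_wpDl.
have dn : d * n <= 2 * b * n'.
  move: dq; rewrite ler_pdivlMr ?mulr_gt0// mulrA => dq.
  have : 0 <= d * n by rewrite mulr_ge0// ltW.
  by nra.
rewrite [leLHS](_ : _ = d * (4 * q) / n'); last first.
  by field; rewrite (gt_eqF n'0) (gt_eqF s2).
rewrite ler_pdivrMr//.
apply: (@le_trans _ _ (4 * b * (d * n))).
  rewrite [leRHS](_ : _ = d * (4 * (b * n))); last by ring.
  by rewrite ler_wpM2l// ler_wpM2l.
apply: (@le_trans _ _ (4 * b * (2 * b * n'))).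
  by rewrite ler_wpM2l// mulr_ge0// ltW.
by rewrite (_ : 4 * b * _ = 8 * b ^+ 2 * n')//; ring.
Qed.

End limit_sets.

(** * Accumulation on the limit set *)

Section limit_set_dynamics.
Variable R : realType.
Variables (G : set (PSL2 R)) (p : 'rV[R]_3) (B : SL2 R).
Hypothesis sG : subgroup G.
Hypothesis pB : forall A : SL2 R,
  ball_act (\pi_(PSL2 R) A) p = frame_point (val (A * B)%g).

Lemma subgroup1 : G 1%g.
Proof. by have [/set_mem] := sG. Qed.

Lemma subgroup_div g h : G g -> G h -> G (g / h)%g.
Proof. by move=> Gg Gh; apply/set_mem; apply: sG.2; exact/mem_set. Qed.

Lemma subgroupV g : G g -> G g^-1%g.
Proof. by move=> Gg; rewrite -[g^-1%g]mul1g; exact: subgroup_div subgroup1 Gg. Qed.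

Lemma subgroupM g h : G g -> G h -> G (g * h)%g.
Proof. by move=> Gg /subgroupV Gh; rewrite -[h]invgK; exact: subgroup_div. Qed.

(** The orbit lies in the open ball, so that its points automatically differ
    from the boundary point that they approach. *)
Lemma limit_set_frameP z : limit_set p G z <-> forall e, 0 < e ->
  exists2 A : SL2 R, G (\pi_(PSL2 R) A) &
    sqnorm (stereo z - frame_point (val (A * B)%g)) < e.
Proof.
split=> [zL e e0|zL U /nbhs_sqnormP[e e0 eU]].
  have /zL[_ [_ [g Gg <-]]] :
      nbhs (stereo z) [set y | sqnorm (stereo z - y) < e].
    by apply/nbhs_sqnormP; exists e => // y /=; rewrite -sqnormN opprB.
  rewrite /= -[g]reprK pB => ge.
  by exists (repr g); rewrite ?reprK.
have [A GA Ae] := zL e e0; exists (frame_point (val (A * B)%g)); split.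
- apply/eqP => Az; have := dist_frame_point_gt0 (A * B)%g z.
  by rewrite Az subrr sqnormE !mxE expr0n !addr0 ltxx.
- by exists (\pi_(PSL2 R) A); rewrite ?pB.
- by apply: eU; rewrite -sqnormN opprB.
Qed.

Lemma limit_set_closed z :
  (forall e, 0 < e ->
    exists2 w, limit_set p G w & sqnorm (stereo z - stereo w) < e) ->
  limit_set p G z.
Proof.
move=> zL; apply/limit_set_frameP => e e0.
have e4 : 0 < e / 4 by rewrite divr_gt0.
have [w /limit_set_frameP/(_ _ e4)[A GA Aw] zw] := zL _ e4.
exists A => //; apply: le_lt_trans (sqnorm_triangle _ (stereo w) _) _.
by lra.
Qed.

Lemma limit_set_invariant g z : G g -> limit_set p G z ->
  limit_set p G (moebius g z).
Proof.
have [v v0 ->] := sphere_point_surj z.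
move=> Gg zL; apply/limit_set_frameP => e e0; rewrite moebius_sphere_point//.
have := frob2_SL2_gt0 (repr g) => a0; set a := frob2 (val (repr g)) in a0.
have c0 : 0 < a * (a + 1) by rewrite mulr_gt0 ?addr_gt0.
have /limit_set_frameP/(_ (e / (a * (a + 1))))[|A GA Az] := zL.
  by rewrite divr_gt0.
exists (repr g * A)%g; first by rewrite -PSL2_mulE reprK; exact: subgroupM.
rewrite -mulgA; apply: le_lt_trans (dist_frame_point_lipschitz _ _ v0) _.
by rewrite mulrC -ltr_pdivlMr.
Qed.

Lemma finite_pos_lbound (T : choiceType) (S : set T) (f : T -> R) :
  finite_set S -> (forall x, S x -> 0 < f x) ->
  exists2 r, 0 < r & forall x, S x -> r <= f x.
Proof.
move=> /finite_seqP[s ->] /=; elim: s => [|x s IH] f0; first by exists 1.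
have [y ys|r r0 rs] := IH; first by apply: f0; rewrite inE ys orbT.
exists (Num.min r (f x)).
  by rewrite lt_min r0 f0// inE eqxx.
move=> y; rewrite inE ge_min => /predU1P[->|/rs->//]; by rewrite lexx orbT.
Qed.

(** Accumulation points of an orbit on the sphere are in the limit set, even when
    [z] is: in that case the estimate [dist_frame_point_expansion] is void, and
    invariance and closedness of the limit set replace it. *)
Lemma accumulation_limit_set z w : discrete_subset G ->
  (forall e, 0 < e -> exists2 g, G g & moebius g z != w /\
     sqnorm (stereo w - stereo (moebius g z)) < e) ->
  limit_set p G w.
Proof.
move=> dG wz.
have [zL|] := pselect (limit_set p G z).
  apply: limit_set_closed => e /wz[g Gg [_ gw]].
  by exists (moebius g z) => //; exact: limit_set_invariant.
rewrite limit_set_frameP => /existsNP[d /not_implyP[d0 zNL]].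
have zd A : G (\pi_(PSL2 R) A) ->
    d <= sqnorm (stereo z - frame_point (val (A * B)%g)).
  by move=> GA; rewrite leNgt; apply/negP => Ad; apply: zNL; exists A.
apply/limit_set_frameP => e e0.
set b := frob2 (val B); have b0 : 0 < b := frob2_SL2_gt0 B.
(* Chosen so that [K < |A|^2] makes the bound [8 |B|^4 / (d (|AB|^2 + 2))] less
   than [e / 4], given [|A|^2 <= |B|^2 |AB|^2]. *)
pose K := 32 * b ^+ 3 / (d * e).
(* The value 1 excludes the elements mapping [z] to [w] itself from the bound. *)
pose f g := if moebius g z == w then 1
  else sqnorm (stereo w - stereo (moebius g z)).
have [|r r0 rf] := @finite_pos_lbound _ _ f (discrete_finite K sG dG).
  move=> g _; rewrite /f; case: eqVneq => // gw.
  rewrite lt_def sqnorm_ge0 andbT; apply: contra gw => /eqP/sqnorm_eq0/eqP.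
  by rewrite subr_eq0 => /eqP/stereo_inj->.
have [|g Gg [gw wg]] := wz (Num.min r (e / 4)).
  by rewrite lt_min r0 divr_gt0.
move: wg; rewrite lt_min => /andP[wgr wge].
set A := repr g; have GA : G (\pi_(PSL2 R) A) by rewrite reprK.
have KA : K < frob2 (val A).
  rewrite ltNge; apply/negP => AK; have := rf g (conj Gg AK).
  by rewrite /f (negbTE gw) leNgt wgr.
exists A => //; apply: le_lt_trans (sqnorm_triangle _ (stereo (moebius g z)) _) _.
suff : sqnorm (stereo (moebius g z) - frame_point (val (A * B)%g)) < e / 4 by lra.
have GV : G (\pi_(PSL2 R) A^-1%g) by rewrite -PSL2_invE; exact: subgroupV.
have := zd _ GV; have [v v0 ->] := sphere_point_surj z.
rewrite moebius_sphere_point// -/A.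
move=> /(dist_frame_point_expansion v0 (ltW d0)); rewrite -/b.
have AAB : frob2 (val A) <= b * frob2 (val (A * B)%g).
  rewrite -[A in leLHS](mulgK B); apply: le_trans (frob2_mulmx _ _) _.
  by rewrite frob2_invmx ?det_SL2// mulrC.
move: (sqnorm _) (frob2 (val (A * B)%g)) AAB => x s AAB xb.
have s0 : 32 * b ^+ 2 < d * e * s.
  have : K < b * s by exact: lt_le_trans KA AAB.
  rewrite /K ltr_pdivrMr ?mulr_gt0//.
  rewrite (_ : 32 * b ^+ 3 = b * (32 * b ^+ 2)); last by ring.
  by rewrite [ltRHS](_ : _ = b * (d * e * s)) ?ltr_pM2l//; ring.
have s1 : 0 < s.
  have : 0 < d * e * s by apply: le_lt_trans s0; rewrite mulr_ge0 ?sqr_ge0.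
  by rewrite pmulr_rgt0 ?mulr_gt0.
rewrite ltNge; apply/negP => ex.
have : d * (s + 2) * (e / 4) <= 8 * b ^+ 2.
  by apply: le_trans xb; rewrite ler_wpM2l// mulr_ge0 ?(ltW d0)// ltW// ltr_wpDl// ltW.
have : 0 < d * e by rewrite mulr_gt0.
by lra.
Qed.

End limit_set_dynamics.

(** * Orbits of piecewise conformal maps *)

Section piecewise_conformal_orbits.
Variables (R : realType) (M : nat).
Variables (P : 'I_M -> set (riemann_sphere R)).
Variable F : riemann_sphere R -> riemann_sphere R.

Lemma subgroup_Gamma : subgroup (Gamma P F).
Proof.
split=> [|g h /set_mem Gg /set_mem Gh]; apply/mem_set => S [sS SF].
  exact: subgroup1 sS.
by apply: (subgroup_div sS); [exact: Gg | exact: Gh].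
Qed.

Lemma iter_Gamma n z : piecewise_conformal P F ->
  exists2 g, Gamma P F g & iter n F z = moebius g z.
Proof.
move=> [_ Pcover _ _ PF]; elim: n => [|n [g Gg Fn]].
  by exists 1%g; [exact: subgroup1 subgroup_Gamma | rewrite moebius1].
have [m _ Pm] : (\bigcup_m P m) (iter n F z) by rewrite Pcover.
have [h hF] := PF m; exists (h * g)%g; last by rewrite moebiusM -Fn /= hF.
apply: (subgroupM subgroup_Gamma) => //.
by apply: sub_gen_smallest; exists m.
Qed.

End piecewise_conformal_orbits.

Theorem theorem3 (R : realType) (M : nat) (P : 'I_M -> set (riemann_sphere R))
    (F : riemann_sphere R -> riemann_sphere R) (p : 'rV[R]_3)
    (hp : open_unit_ball p)
    (hF : piecewise_conformal P F)
    (hG : discrete_subset (Gamma P F))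
    (z : riemann_sphere R) :
  omega_limit F z `<=` limit_set p (Gamma P F).
Proof.
move=> w wz; have [B [d [d0 pB]]] := ball_frame hp.
apply: (accumulation_limit_set (z := z) (subgroup_Gamma P F)
  (ball_act_frame_point d0 pB) hG) => e e0.
have [y [yw [n _ ny] wy]] := wz _ (nbhs_stereo w e0).
have [g Gg Fn] := iter_Gamma n z hF.
by exists g => //; rewrite -Fn ny; split=> //; rewrite -sqnormN opprB.
Qed.
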